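(* Let $X$ be a real Hausdorff locally convex space, $T$ a topological space, $f_t:X\to\overline{\mathbb{R}}$ ($t\in T$) convex functions, and $f:=\sup_{t\in T}f_t$. Assume that $\operatorname{ri}(\operatorname{dom}f)$ is nonempty and that the restriction $f_{|\operatorname{aff}(\operatorname{dom}f)}$ is finite and continuous on $\operatorname{ri}(\operatorname{dom}f)$. Suppose that $$\operatorname{cl}f=\sup_{t\in T}(\operatorname{cl}f_t).$$ Let $x\in X$ be such that for some $\varepsilon_0>0$: (i) the set $T_{\varepsilon_0}(x)$ is compact; (ii) for every $z\in\operatorname{dom}f$, the function $t\mapsto f_t(z)$ is upper semicontinuous on $T_{\varepsilon_0}(x)$. Then $$\partial f(x)=\overline{\operatorname{co}}\Big\{\bigcup_{t\in T(x)}\partial(f_t+\mathrm{I}_{\operatorname{dom}f})(x)\Big\}.$$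
   Context: $\overline{\mathbb{R}}=\mathbb{R}\cup\{\pm\infty\}$, with the convention $(+\infty)+(-\infty)=(-\infty)+(+\infty)=+\infty$. $X^*$ is the topological dual of $X$, endowed with the weak*-topology, and $\langle\cdot,\cdot\rangle$ is the canonical pairing. For a convex $\varphi:X\to\overline{\mathbb{R}}$: $\operatorname{dom}\varphi=\{x\in X:\varphi(x)<+\infty\}$; $\operatorname{cl}\varphi$ is the lower semicontinuous envelope of $\varphi$; the subdifferential is $\partial\varphi(x)=\{x^*\in X^*:\varphi(y)-\varphi(x)\ge\langle x^*,y-x\rangle\ \forall y\in X\}$ if $\varphi(x)\in\mathbb{R}$, and $\partial\varphi(x)=\emptyset$ if $\varphi(x)\notin\mathbb{R}$. $\mathrm{I}_A$ is the indicator function of $A$ ($0$ on $A$, $+\infty$ off $A$). $\operatorname{aff}A$ is the affine hull of $A$; $\operatorname{ri}A$ is the interior of $A$ relative to $\operatorname{aff}A$ if $\operatorname{aff}A$ is closed, and $\operatorname{ri}A=\emptyset$ otherwise. $\overline{\operatorname{co}}$ is the closed convex hull (weak*-closed for subsets of $X^*$). Active index sets: $T_\varepsilon(x)=\{t\in T: f_t(x)\ge f(x)-\varepsilon\}$ for $\varepsilon\ge0$, and $T(x)=\{t\in T: f_t(x)=f(x)\}$. *)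

(* Defs.v *)
From HB Require Import structures.
From mathcomp Require Import all_boot all_order all_algebra.
From mathcomp Require Import interval_inference.
From mathcomp Require Import all_classical reals ereal topology normedtype convex.

Set Implicit Arguments.
Unset Strict Implicit.
Unset Printing Implicit Defensive.

Import Order.TTheory GRing.Theory Num.Theory.
Import numFieldNormedType.Exports.

Local Open Scope classical_set_scope.
Local Open Scope ring_scope.

Section Dual.
Context {R : realType} (X : tvsType R).

Definition continuous_linear : {pred X -> R^o} :=
  mem [set l : X -> R^o | linear l /\ continuous l].

Lemma continuous_linear_submod : submod_closed continuous_linear.
Proof.
split.
  rewrite inE; split; last by move=> x; exact: cvg_cst.
  by move=> a u v; rewrite /= scaler0 addr0.
move=> a l m; rewrite !inE => -[ll lc] [ml mc]; split.
  move=> b u v; rewrite !fctE ll ml !scalerDr !scalerA -!addrA.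
  by congr (_ + _); [rewrite mulrC|rewrite addrCA].
move=> x; apply: cvgD; last exact: mc.
by apply: cvgZl_tmp; exact: lc.
Qed.

HB.instance Definition _ :=
  GRing.isSubmodClosed.Build R (X -> R^o) continuous_linear
    continuous_linear_submod.

Record dual := Dual {
  dual_fun :> X -> R^o ;
  dual_funP : dual_fun \in continuous_linear }.

HB.instance Definition _ := [isSub for dual_fun].
HB.instance Definition _ := [Choice of dual by <:].
HB.instance Definition _ := [SubChoice_isSubLmodule of dual by <:].

(* weak* topology: the one induced by pointwise convergence on X *)
HB.instance Definition _ := Topological.copy dual
  (initial_topology (dual_fun : dual -> {ptws X -> R^o})).

End Dual.

Definition closed_convex_hull (R : realType) (X : tvsType R)
    (A : set (dual X)) : set (dual X) :=
  smallest [set C | convex_set C /\ closed C] A.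

Section AffineHull.
Context {R : realType} {X : tvsType R}.
Implicit Types A : set X.

Definition affine_set A :=
  forall (x y : X) (a : R), A x -> A y -> A (a *: x + (1 - a) *: y).

Definition aff A : set X := smallest affine_set A.

(* [interior] is taken in the subspace topology of [aff A]; points outside
   [aff A] are isolated there, but they do not lie in [A]. *)
Definition ri A : set X :=
  [set x | closed (aff A) /\ @interior (subspace (aff A)) A x].

End AffineHull.

Section ExtendedRealFunctions.
Context {R : realType} {X : tvsType R}.
Implicit Types (f : X -> \bar R) (A : set X).

(* The sum in [%dE] is the one with +oo + -oo = -oo + +oo = +oo. *)
Definition econvex f := forall (x y : X) (a : R), 0 < a -> a < 1 ->
  (f (a *: x + (1 - a) *: y)%R <= a%:E * f x + (1 - a)%R%:E * f y)%dE.

Definition dom f : set X := [set x | (f x < +oo)%E].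

Definition eindicator A (x : X) : \bar R := if x \in A then 0%E else +oo%E.

(* greatest lower semicontinuous minorant *)
Definition lsc_envelope f (x : X) : \bar R :=
  ereal_sup [set g x | g in
    [set g : X -> \bar R | lower_semicontinuous g /\
                           forall y, (g y <= f y)%E]].

Definition subdifferential f (x : X) : set (dual X) :=
  [set l : dual X | f x \is a fin_num /\
                    forall y, ((l (y - x)%R)%:E <= f y - f x)%E].

End ExtendedRealFunctions.

Definition upper_semicontinuous (R : realType) (Y : topologicalType)
    (g : Y -> \bar R) := forall y (a : R), (g y < a%:E)%E ->
  exists2 V, nbhs y V & forall z, V z -> (g z < a%:E)%E.

Section Supremum.
Context {R : realType} {X : tvsType R} {T : Type}.
Implicit Types F : T -> X -> \bar R.

Definition psup F (x : X) : \bar R := ereal_sup [set F t x | t in [set: T]].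

Definition eps_active F (e : R) (x : X) : set T :=
  [set t | (psup F x - e%:E <= F t x)%E].

Definition active F (x : X) : set T := [set t | F t x = psup F x].

End Supremum.

(* Main.v *)
Require Import Defs.
From HB Require Import structures.
From mathcomp Require Import all_boot all_order all_algebra.
From mathcomp Require Import interval_inference.
From mathcomp Require Import all_classical reals ereal topology normedtype convex.
From mathcomp Require Import ring lra.

(** The inclusion of the right-hand side in the subdifferential of the supremum
    f is immediate, that subdifferential being convex and weak*-closed.  For
    the converse it is enough, by separation in the dual space
    ([dual_separation]: a weak* neighbourhood only tests finitely many vectors,
    so that the separating functional is the evaluation at some v of X), to find
    for every subgradient l0 of f at x, every direction v and every eps > 0 an
    active index t and a subgradient l of h_t = f_t + I_(dom f) at x such that
    l v >= l0 v - eps ([active_subgradient]).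

    Suppose that x + v lies in dom f and let c < l0 v.  The sets of indices t of
    T_e0(x) such that f_t(x + s v) >= f(x) + s c are nonempty for small s > 0,
    increase with s by convexity, and are closed by upper semicontinuity; by
    compactness they have a common element t, which is active and whose f_t
    stays above f(x) + r c at x + r v for all r >= 0 ([active_ray]).  If
    moreover f is bounded above around x + v, relatively to aff (dom f), then
    the Hahn-Banach theorem separates the epigraph of h_t from this ray
    ([subgradient_of_ray]), and the separating form is a subgradient of h_t at
    x whose value at v is at least c.

    For v = z0 - x, with z0 in the relative interior of dom f, these conditions
    hold.  The other directions reduce to such ones.  Either v is in the closure of the
    cone generated by dom f - x, and v + k w is, up to a positive factor,
    a direction of the previous kind, for w = z0 - x and k > 0 small.  Or some continuous form n is nonpositive on this
    cone and positive at v ([normal_separation]); adding large multiples of n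
    to any subgradient of h_t keeps it a subgradient and makes its value at v
    as large as desired.

    All the separation arguments are instances of one algebraic statement,
    [linear_below_convex], itself deduced from a form of the Hahn-Banach theorem
    for cones, [linear_below_cone]. *)

Set Implicit Arguments.
Unset Strict Implicit.
Unset Printing Implicit Defensive.

Import Order.TTheory GRing.Theory Num.Theory.
Import numFieldNormedType.Exports.

Local Open Scope classical_set_scope.
Local Open Scope ring_scope.

(** * Equality of linear combinations *)

Section LinearCombinations.
Context {R : realType}.

(** Syntactic linear combinations: a vector is a position in an environment, so
    that equality can be decided coefficient by coefficient. *)
Inductive lincomb :=
  | LZero | LVar of nat | LAdd of lincomb & lincomb | LOpp of lincomb
  | LScale of R & lincomb.

Fixpoint leval (V : lmodType R) (env : seq V) (e : lincomb) : V :=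
  match e with
  | LZero => 0
  | LVar n => env`_n
  | LAdd e1 e2 => leval env e1 + leval env e2
  | LOpp e1 => - leval env e1
  | LScale a e1 => a *: leval env e1
  end.

Fixpoint lcoef (e : lincomb) (i : nat) : R :=
  match e with
  | LZero => 0
  | LVar n => if n == i then 1 else 0
  | LAdd e1 e2 => lcoef e1 i + lcoef e2 i
  | LOpp e1 => - lcoef e1 i
  | LScale a e1 => a * lcoef e1 i
  end.

Lemma leval_eq (V : lmodType R) (env : seq V) (e1 e2 : lincomb) :
  (forall i, (i < size env)%N -> lcoef e1 i = lcoef e2 i) ->
  leval env e1 = leval env e2.
Proof.
suff levalE e : leval env e = \sum_(i < size env) lcoef e i *: env`_i.
  by move=> e12; rewrite !levalE; apply: eq_bigr => i _; rewrite e12.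
elim: e => [|n|e ihe e' ihe'|e ihe|a e ihe] /=.
- by rewrite big1// => i _; rewrite scale0r.
- have [ns|sn] := ltnP n (size env).
    rewrite (bigD1 (Ordinal ns))//= eqxx scale1r big1 ?addr0// => i /eqP ni.
    by rewrite ifF ?scale0r//; apply/negP => /eqP nE; apply: ni; exact/val_inj.
  rewrite nth_default// big1// => i _; rewrite ifF ?scale0r//.
  by apply/negP => /eqP nE; have := ltn_ord i; rewrite -nE ltnNge sn.
- by rewrite ihe ihe' -big_split/=; apply: eq_bigr => i _; rewrite scalerDl.
- by rewrite ihe -sumrN; apply: eq_bigr => i _; rewrite scaleNr.
- by rewrite ihe scaler_sumr; apply: eq_bigr => i _; rewrite scalerA.
Qed.

End LinearCombinations.

Ltac latoms env t :=
  lazymatch t with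
  | @Algebra.zero _ => env
  | @Algebra.add _ ?a ?b => let env := latoms env a in latoms env b
  | @Algebra.opp _ ?a => latoms env a
  | @GRing.scale _ _ _ ?a => latoms env a
  | _ =>
    let rec mem_env l := lazymatch l with
      | t :: _ => env
      | _ :: ?l' => mem_env l'
      | _ => constr:(t :: env)
      end in mem_env env
  end.

Ltac lreify R env t :=
  lazymatch t with
  | @Algebra.zero _ => constr:(@LZero R)
  | @Algebra.add _ ?a ?b =>
    let a := lreify R env a in let b := lreify R env b in constr:(@LAdd R a b)
  | @Algebra.opp _ ?a => let a := lreify R env a in constr:(@LOpp R a)
  | @GRing.scale _ _ ?c ?a => let a := lreify R env a in constr:(@LScale R c a)
  | _ =>
    let rec index l := lazymatch l with
      | t :: _ => constr:(0%N)
      | _ :: ?l' => let n := index l' in constr:(S n)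
      end in let n := index env in constr:(@LVar R n)
  end.

(** Replaces an equality between linear combinations of vectors, with scalars
    in [R], by the equalities between the coefficients of each vector. *)
Ltac module_eq R :=
  lazymatch goal with
  | |- @eq ?T ?a ?b =>
    let env := latoms (@nil T) a in let env := latoms env b in
    let e1 := lreify R env a in let e2 := lreify R env b in
    change (leval env e1 = leval env e2);
    apply: leval_eq; do !case=> [|?] //=; move=> _
  end.

(** * A Hahn-Banach theorem for convex sets *)

Section ConvexSets.
Context {R : realType} {V : lmodType R}.
Implicit Types A : set V.

(** The scalars of [convex_set] range over a type of numbers between 0 and 1;
    here they are plain reals and the end points are left out. *)
Lemma convex_setP A : convex_set A <->
  forall x y (a b : R), 0 < a -> 0 < b -> a + b = 1 -> A x -> A y ->
    A (a *: x + b *: y).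
Proof.
split=> [cA x y a b a0 b0 ab Ax Ay|cA].
  have -> : b = 1 - a by lra.
  have := cA x y (Itv01 (ltW a0) ltac:(lra)) (mem_set Ax) (mem_set Ay).
  by rewrite inE.
apply/convex_setW => x y; rewrite !inE => Ax Ay k k0 k1.
rewrite inE; apply: (cA x y k%:num (1 - k%:num)) => //.
  by rewrite subr_gt0.
by rewrite addrC subrK.
Qed.

(** The scalars are positive because the cones generated below by convex sets
    need not contain 0. *)
Definition convex_cone A :=
  (forall x y, A x -> A y -> A (x + y)) /\
  (forall (a : R) x, 0 < a -> A x -> A (a *: x)).

End ConvexSets.

(** Passage to the limit g -> 0 in an inequality that is affine in g. *)
Lemma ler_affine_near0 (R : realType) (g0 a b c d : R) : 0 < g0 ->
  (forall g, 0 < g -> g <= g0 -> a + g * b <= c + g * d) -> a <= c.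
Proof.
move=> g0_gt0 H; rewrite leNgt; apply/negP => ca.
pose n := `|d - b| + 1.
have n0 : 0 < n by rewrite /n ltr_wpDl.
have e0 : 0 < (a - c) / (2 * n) by rewrite divr_gt0 ?subr_gt0// mulr_gt0.
set e := (a - c) / (2 * n) in e0.
pose g := Num.min g0 e.
have g_gt0 : 0 < g by rewrite lt_min g0_gt0.
have /H : g <= g0 by rewrite ge_min lexx.
move=> /(_ g_gt0).
have : g * (d - b) <= g * n.
  by rewrite ler_pM2l// /n (le_trans (ler_norm _))// lerDl.
have : g * n <= e * n by rewrite ler_pM2r// ge_min lexx orbT.
have -> : e * n = (a - c) / 2 by rewrite /e; field; rewrite gt_eqF.
lra.
Qed.

Section LinearForms.
Context {R : realType} {V : lmodType R} (m : V -> R^o) (lm : linear m).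

Lemma linear_formD u v : m (u + v) = m u + m v.
Proof. by have := lm 1 u v; rewrite !scale1r. Qed.

Lemma linear_form0 : m 0 = 0.
Proof. by apply: (addrI (m 0)); rewrite -linear_formD !addr0. Qed.

Lemma linear_formZ (a : R) u : m (a *: u) = a * m u.
Proof. by have := lm a u 0; rewrite linear_form0 !addr0. Qed.

End LinearForms.

Section HahnBanach.
Context {R : realType} {V : lmodType R}.
Implicit Types Q : set (V * R^o).

Let proper_cone Q := convex_cone Q /\ forall r, Q (0, r) -> 0 <= r.

Lemma maximal_cone Q : Q !=set0 -> proper_cone Q -> exists A,
  [/\ Q `<=` A, proper_cone A &
      forall B, A `<=` B -> proper_cone B -> B `<=` A].
Proof.
move=> [q Qq] pQ.
(* the union of the empty chain is empty, whence the first disjunct *)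
pose P := [set A | A = set0 \/ (Q `<=` A /\ proper_cone A)].
have [F FP Ftot|A [PA maxA]] := @Zorn_bigcup _ P.
  have [[A FA QA]|F0] := pselect (exists2 A, F A & Q `<=` A); last first.
    left; rewrite -subset0 => z [A FA Az].
    by have [A0|[QA _]] := FP _ FA; [rewrite A0 in Az|case: F0; exists A].
  right; split; first by move=> z Qz; exists A => //; exact: QA.
  have cF B z : F B -> B z -> proper_cone B.
    by move=> FB Bz; have [B0|[_ pB]] := FP _ FB; [rewrite B0 in Bz|].
  split; first split.
  - move=> y z [B FB By] [C FC Cz].
    have [BC|CB] := Ftot _ _ FB FC.
      by exists C => //; apply: (cF _ _ FC Cz).1.1 => //; exact: BC.
    by exists B => //; apply: (cF _ _ FB By).1.1 => //; exact: CB.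
  - by move=> a z a0 [B FB Bz]; exists B => //; apply: (cF _ _ FB Bz).1.2.
  - by move=> r [B FB B0r]; apply: (cF _ _ FB B0r).2.
have [A0|[QA pA]] := PA.
  exfalso; apply: (maxA Q); last by right; split.
  by split; [rewrite A0|move=> /(_ _ Qq); rewrite A0].
exists A; split => // B AB pB z Bz; apply: contrapT => nAz.
apply: (maxA B); first by split => // /(_ _ Bz).
by right; split => //; exact: subset_trans AB.
Qed.

(** Hahn-Banach theorem, read on epigraphs.  Take a maximal cone A among those
    that contain Q and meet the line over 0 only in nonnegative numbers.  The
    infimum p of the fibres of A is sublinear.  It is odd: the cone generated by
    A and the opposite of the point (u, p u) still has the two properties, so
    that A cannot be smaller.  So p is linear. *)
Lemma linear_below_cone Q : convex_cone Q -> (forall u, exists r, Q (u, r)) ->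
    (forall r, Q (0, r) -> 0 <= r) ->
  exists m : V -> R^o, linear m /\ forall u r, Q (u, r) -> m u <= r.
Proof.
move=> cQ totQ Q0.
have [||A [QA [[Aadd Ascale] A0] maxA]] := @maximal_cone Q.
- by have [r Qr] := totQ 0; exists (0, r).
- by [].
have totA u : exists r, A (u, r) by have [r /QA] := totQ u; exists r.
pose p (u : V) : R := inf [set r | A (u, r)].
have lbA u : has_inf [set r : R | A (u, r)].
  split; first by have [r] := totA u; exists r.
  have [s As] := totA (- u); exists (- s) => r /= Ar.
  have /A0 : A (0, r + s) by rewrite -(subrr u); exact: (Aadd _ _ Ar As).
  by rewrite -lerBlDr sub0r.
have pA u r : A (u, r) -> p u <= r.
  by move=> Ar; apply: ge_inf => //; exact: (lbA u).2.
have p_ge u r : (forall s, A (u, s) -> r <= s) -> r <= p u.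
  by move=> rA; apply: lb_le_inf => //; exact: (lbA u).1.
have pD u v : p (u + v) <= p u + p v.
  rewrite -lerBlDr; apply: (p_ge) => s As; rewrite lerBlDl -lerBlDr.
  apply: (p_ge) => r Ar; rewrite lerBlDr [r + s]addrC; apply: pA.
  exact: (Aadd _ _ As Ar).
have pN u : p (- u) = - p u.
  apply/eqP; rewrite eq_le; apply/andP; split; last first.
    rewrite -subr_ge0 opprK addrC; apply: le_trans (pD _ _).
    by rewrite subrr; exact: p_ge.
  (* the cone spanned by A and (- u, - p u) is still proper *)
  pose B : set (V * R^o) := [set z | exists (a : R) (w : V * R^o),
    [/\ 0 <= a, A w & z = w + a *: (- u, - p u : R^o)]].
  have AB : A `<=` B by move=> z Az; exists 0, z; rewrite scale0r addr0.
  have pB : proper_cone B.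
    split; first split.
    - move=> _ _ [a [w [a0 Aw ->]]] [b [w' [b0 Aw' ->]]].
      exists (a + b), (w + w'); split; [exact: addr_ge0|exact: Aadd|].
      by rewrite scalerDl addrACA.
    - move=> b _ b0 [a [w [a0 Aw ->]]]; exists (b * a), (b *: w).
      rewrite scalerDr scalerA mulr_ge0 ?(ltW b0)//.
      by split => //; exact: Ascale.
    - move=> r [a [[k s] [a0 Aw]]] [] /eqP; rewrite scalerN eq_sym subr_eq0.
      move=> /eqP ku ->; rewrite ku in Aw.
      have [a00|an0] := eqVneq a 0.
        by move: Aw; rewrite a00 !scale0r addr0 => /A0.
      have {}a0 : 0 < a by rewrite lt0r an0.
      have ai0 : 0 < a^-1 by rewrite invr_gt0.
      have : A (u, a^-1 * s).
        rewrite -[u]scale1r -(@mulVf _ a)// -scalerA.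
        exact: (Ascale _ _ ai0 Aw).
      move=> /pA; rewrite -(ler_pM2l a0) mulVKf// => pus.
      by rewrite [_ *: _]mulrN subr_ge0.
  have [r Ar] := totA 0.
  apply: (@ler_affine_near0 _ 1 _ 0 _ r) => // g g0 _; rewrite mulr0 addr0.
  apply: pA; apply: (maxA B AB pB).
  exists 1, (g *: (0, r)); split => //; first exact: Ascale.
  by rewrite scale1r; congr pair; rewrite /= ?scaler0 ?add0r// addrC.
have pDe u v : p (u + v) = p u + p v.
  apply/eqP; rewrite eq_le pD/=.
  by rewrite -[X in p X + _](addrK v) -lerBrDr -pN pD.
have pZ (a : R) u : 0 < a -> p (a *: u) <= a * p u.
  move=> a0; rewrite -ler_pdivrMl//; apply: (p_ge) => s As.
  by rewrite ler_pdivrMl//; apply: pA; exact: Ascale As.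
have pZe (a : R) u : 0 < a -> p (a *: u) = a * p u.
  move=> a0; apply/eqP; rewrite eq_le pZ//=.
  have := pZ a^-1 (a *: u); rewrite invr_gt0 => /(_ a0).
  by rewrite scalerA mulVf ?gt_eqF// scale1r -ler_pdivlMl ?invr_gt0// invrK.
have p0 : p 0 = 0 by have := pDe 0 0; rewrite addr0 => ?; lra.
exists p; split; last by move=> u r /QA /pA.
move=> a u v; rewrite pDe; congr (_ + _).
have [a0|a0|<-] := ltgtP 0 a; [exact: pZe| |by rewrite !scale0r p0].
by rewrite -[a]opprK scaleNr pN pZe ?oppr_gt0// scaleNr.
Qed.

(** For M >= 0 the hypothesis says that S lies above -M times the gauge of -U;
    the cone generated by S and by the points (e, M), for e in U, then satisfies
    the assumptions of [linear_below_cone].  The bound on U is what makes the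
    form continuous when U is a neighbourhood of 0. *)
Lemma linear_below_convex (U : set V) (S : set (V * R^o)) (M : R) :
  convex_set U -> (forall u, exists2 g : R, 0 < g & U (g^-1 *: u)) ->
  convex_set S -> S !=set0 ->
  (forall k s g e, S (k, s) -> 0 < g -> U e -> k + g *: e = 0 ->
     0 <= s + g * M) ->
  exists m : V -> R^o, [/\ linear m, forall k s, S (k, s) -> m k <= s &
     exists B, forall u, U u -> m u <= B].
Proof.
move=> /convex_setP cU absU /convex_setP cS [[k0 s0] S0] SU.
pose Q : set (V * R^o) := [set z | exists (a g : R) k s e,
  [/\ 0 < a, 0 < g, S (k, s), U e &
      z = (a *: k + g *: e, a * s + g * M : R^o)]].
have [|u|r|m [lm mQ]] := @linear_below_cone Q.
- split.
    move=> _ _ [a [g [k [s [e [a0 g0 Sk Ue ->]]]]]]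
      [a' [g' [k' [s' [e' [a'0 g'0 Sk' Ue' ->]]]]]].
    have aa0 : 0 < a + a' by rewrite addr_gt0.
    have gg0 : 0 < g + g' by rewrite addr_gt0.
    exists (a + a'), (g + g'), ((a / (a + a')) *: k + (a' / (a + a')) *: k').
    exists ((a / (a + a')) * s + (a' / (a + a')) * s').
    exists ((g / (g + g')) *: e + (g' / (g + g')) *: e').
    split => //.
    + apply: (cS (k, s) (k', s')) => //; rewrite ?divr_gt0//.
      by rewrite -mulrDl divff// gt_eqF.
    + by apply: cU => //; rewrite ?divr_gt0// -mulrDl divff// gt_eqF.
    + congr pair; rewrite /=.
        by module_eq R; field; rewrite ?(gt_eqF aa0) ?(gt_eqF gg0).
      by field; rewrite gt_eqF.
  move=> b _ b0 [a [g [k [s [e [a0 g0 Sk Ue ->]]]]]].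
  exists (b * a), (b * g), k, s, e; rewrite !mulr_gt0//; split => //.
  by congr pair; rewrite /= ?scalerDr ?scalerA.
- have [g g0 Ug] := absU (u - k0).
  exists (1 * s0 + g * M), 1, g, k0, s0, (g^-1 *: (u - k0)); split => //.
  by rewrite scalerA divff ?gt_eqF// !scale1r [k0 + _]addrC subrK.
- move=> [a [g [k [s [e [a0 g0 Sk Ue [e0 ->]]]]]]].
  have ke0 : k + (a^-1 * g) *: e = 0.
    have -> : k + (a^-1 * g) *: e = a^-1 *: (a *: k + g *: e).
      by module_eq R; field; rewrite gt_eqF.
    by rewrite -e0 scaler0.
  have := SU _ _ _ _ Sk (_ : 0 < a^-1 * g) Ue ke0.
  rewrite mulr_gt0 ?invr_gt0// => /(_ isT).
  by rewrite -(pmulr_rge0 _ a0) mulrDr mulrA mulVKf ?gt_eqF.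
have lD (a b : R) u v : m (a *: u + b *: v) = a * m u + b * m v.
  by rewrite (linear_formD lm) !(linear_formZ lm).
exists m; split => //.
  move=> k s Sk; have [g0 g0p Ue0] := absU 0; rewrite scaler0 in Ue0.
  apply: (@ler_affine_near0 _ 1 _ (m 0) _ M) => // g gp _.
  rewrite -[m k]mul1r -lD -[s]mul1r; apply: mQ.
  by exists 1, g, k, s, 0.
exists (s0 + M - m k0) => u Uu.
rewrite lerBrDl -[m k0]mul1r -[m u]mul1r -lD -[s0]mul1r -[M]mul1r.
by apply: mQ; exists 1, 1, k0, s0, u.
Qed.

End HahnBanach.

(** * Topological vector spaces and their duals *)

Section Tvs.
Context {R : realType} {X : tvsType R}.
Implicit Types U W : set X.

Lemma nbhs0_absorbing U : nbhs (0 : X) U ->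
  forall u, exists2 g : R, 0 < g & U (g^-1 *: u).
Proof.
move=> U0 u.
have := @scale_continuous R X (0, u) U; rewrite scale0r => /(_ U0) [] /= B [].
move=> [e e0 eB1] B2 BU.
exists (2 / e); first by rewrite divr_gt0.
apply: (BU ((2 / e)^-1, u)); split => /=; last exact: nbhs_singleton B2.
apply: eB1; rewrite /ball_/= sub0r normrN ger0_norm ?invr_ge0 ?divr_ge0 ?ltW//.
by rewrite invf_div ltr_pdivrMr//; rewrite ltr_pMr// ltr1n.
Qed.

Lemma nbhs_convex (x : X) W : nbhs x W ->
  exists U, [/\ convex_set U, nbhs x U & U `<=` W].
Proof.
have [B cB [Bopen Bbasis]] := @locally_convex R X.
move=> /Bbasis [U [BU Ux] UW]; exists U; split => //.
  by apply: cB; rewrite inE.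
by apply: open_nbhs_nbhs; split => //; exact: Bopen.
Qed.

Lemma nbhsD0 (x : X) W : nbhs x W <-> nbhs (0 : X) [set e | W (x + e)].
Proof.
split=> [Wx|W0].
  have := @add_continuous X (x, 0) W.
  rewrite addr0 => /(_ Wx) [] /= B [B1 B2] BW.
  apply: filterS B2 => e B2e; apply: (BW (x, e)); split => //.
  exact: nbhs_singleton B1.
by have := nbhsT x W0; apply: filterS => _ [e We <-].
Qed.

Lemma linear_bounded_continuous (m : X -> R^o) U B : linear m ->
  nbhs (0 : X) U -> (forall u, U u -> m u <= B) -> continuous m.
Proof.
move=> lm U0 mB.
have m0 := linear_form0 lm; have mD := linear_formD lm.
have mZ := linear_formZ lm.
have B0 : 0 <= B by rewrite -m0; apply: mB; exact: nbhs_singleton U0.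
move=> x; apply/cvgrPdist_le => e e0.
have d0 : 0 < e / (B + 1) by rewrite divr_gt0// ltr_wpDl.
pose W := U `&` [set - u | u in U].
have W0 : nbhs (0 : X) W by apply: filterI => //; exact: nbhs0N.
have := nbhs0Z (lt0r_neq0 d0) W0.
move=> /(nbhsT x); apply: filterS => _ [_ [w [Uw [w' Uw' ww']] <-] <-].
rewrite mD mZ opprD addrA subrr sub0r normrN normrM gtr0_norm//.
rewrite -mulrA ger_pMr// ler_pdivrMl ?ltr_wpDl// mulr1 ler_norml.
have := mB _ Uw; have := mB _ Uw'; rewrite -ww' -scaleN1r mZ.
by move=> h1 h2; apply/andP; split; lra.
Qed.

Lemma dual_of_linear (m : X -> R^o) U B : linear m -> nbhs (0 : X) U ->
  (forall u, U u -> m u <= B) -> exists l : dual X, l = m :> (X -> R^o).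
Proof.
move=> lm U0 mB.
have ml : m \in @continuous_linear R X
  by rewrite inE; split => //; exact: linear_bounded_continuous mB.
by exists (Dual ml).
Qed.

Lemma dual_linear (l : dual X) : linear l.
Proof. by have := dual_funP l; rewrite inE => -[]. Qed.

Lemma dualD (l : dual X) u v : l (u + v) = l u + l v.
Proof. exact: linear_formD (dual_linear l) u v. Qed.

Lemma dual0 (l : dual X) : l 0 = 0.
Proof. exact: linear_form0 (dual_linear l). Qed.

Lemma dualZ (l : dual X) (a : R) u : l (a *: u) = a * l u.
Proof. exact: linear_formZ (dual_linear l) a u. Qed.

Lemma dualN (l : dual X) u : l (- u) = - l u.
Proof. by rewrite -scaleN1r dualZ mulN1r. Qed.

Lemma dual_eval_continuous (v : X) : continuous (fun l : dual X => l v : R^o).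
Proof.
move=> l; apply: (@continuous_comp (dual X) {ptws X -> R^o} R^o
  (@dual_fun R X) (@^~ v)); first exact: initial_continuous.
exact: (@proj_continuous X (fun=> R^o) v).
Qed.

(** The sets A that satisfy the conclusion for some s and e form a filter, which
    converges to l pointwise, hence is finer than the neighbourhood filter. *)
Lemma weak_star_nbhs (l : dual X) (A : set (dual X)) : nbhs l A ->
  exists (s : seq X) (e : R), 0 < e /\
    forall k : dual X, (forall v, v \in s -> `|k v - l v| < e) -> A k.
Proof.
move=> Al.
pose F : set_system (X -> R^o) := [set P | exists (s : seq X) (e : R), 0 < e /\
    forall k : X -> R^o, (forall v, v \in s -> `|k v - l v| < e) -> P k].
have FF : Filter F.
  split.
  - by exists [::], 1.
  - move=> P Q [s [e [e0 sP]]] [s' [e' [e'0 sQ]]].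
    exists (s ++ s'), (Num.min e e'); split; first by rewrite lt_min e0.
    move=> k sk; split.
      apply: sP => v vs; have := sk v; rewrite mem_cat vs lt_min => /(_ isT).
      by case/andP.
    apply: sQ => v vs; have := sk v; rewrite mem_cat vs orbT lt_min => /(_ isT).
    by case/andP.
  - by move=> P Q PQ [s [e [e0 sP]]]; exists s, e; split => // k /sP /PQ.
have Fl : {ptws, F --> (l : X -> R^o)}.
  apply/pointwise_cvgP => v; apply/cvgrPdist_lt => e e0.
  exists [:: v], e; split => // k /(_ v); rewrite inE eqxx distrC; exact.
move: Al => [_ [[B Bop <-] Bl BA]].
have /Fl [s [e [e0 sB]]] : nbhs ((l : X -> R^o) : {ptws X -> R^o}) B.
  by rewrite nbhsE; exists B.
by exists s, e; split => // k /sB /BA.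
Qed.

(** A weak* neighbourhood of l0 that misses C is given by finitely many vectors
    s and some e > 0.  The values on s of the elements of C - l0 form a convex
    set of 'rV_n that misses the cube of radius e; a linear form separating it
    from the cube is the evaluation at a combination of the vectors s. *)
Lemma dual_separation (C : set (dual X)) (l0 : dual X) :
  convex_set C -> closed C -> C !=set0 -> ~ C l0 ->
  exists v : X, forall l, C l -> l v <= l0 v - 1.
Proof.
move=> /convex_setP cC clC [k0 Ck0] Cl0.
have := open_nbhs_nbhs (conj (closed_openC clC) Cl0).
move=> /weak_star_nbhs [s [e [e0 se]]].
pose n := size s.
pose pr (l : dual X) : 'rV[R]_n := \row_i (l - l0) s`_i.
pose U : set 'rV[R]_n := [set u | forall i, `|u 0 i| < e].
pose S : set ('rV[R]_n * R^o) :=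
  [set z | exists2 l, C l & z = (pr l, -1 : R^o)].
have prE l i : pr l 0 i = l s`_i - l0 s`_i by rewrite mxE.
have [| | | | |m [lm mS _]] := @linear_below_convex R 'rV[R]_n U S 1.
- apply/convex_setP => x y a b a0 b0 ab Ux Uy i; rewrite !mxE.
  apply: le_lt_trans (ler_normD _ _) _.
  rewrite !normrM (gtr0_norm a0) (gtr0_norm b0).
  have -> : e = a * e + b * e by rewrite -mulrDl ab mul1r.
  by apply: ltrD; rewrite ltr_pM2l.
- move=> u; pose g := 1 + \sum_i `|u 0 i| / e.
  have ue_ge0 i : 0 <= `|u 0 i| / e by rewrite divr_ge0// ltW.
  have g0 : 0 < g by rewrite ltr_pwDl// sumr_ge0.
  exists g => // i; rewrite mxE normrM normfV (gtr0_norm g0) mulrC.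
  rewrite ltr_pdivrMr// [e * g]mulrC -ltr_pdivrMr// /g (bigD1 i)//=.
  by rewrite addrCA ltrDl ltr_pwDl// sumr_ge0.
- apply/convex_setP => _ _ a b a0 b0 ab [l Cl ->] [k Ck ->].
  exists (a *: l + b *: k); first exact: cC.
  congr pair; last by rewrite /= !scalerN -opprD -scalerDl ab scale1r.
  apply/rowP => i; rewrite !mxE/=.
  have -> : b = 1 - a by lra.
  by rewrite /= !fctE /= /GRing.scale/=; ring.
- by exists (pr k0, -1); exists k0.
- move=> k r g u [l Cl [-> ->]] g0 Uu lu; rewrite mulr1 addrC subr_ge0.
  rewrite leNgt; apply/negP => g1.
  suff : (~` C) l by [].
  apply: se => v /(nthP 0)[i i_s <-].
  have := congr1 (fun w : 'rV[R]_n => w 0 (Ordinal i_s)) lu.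
  rewrite !mxE/= => /eqP; rewrite addr_eq0 => /eqP.
  move=> prli; have {prli} : l s`_i - l0 s`_i = - (g * u 0 (Ordinal i_s)).
    exact: prli.
  move=> ->; rewrite normrN normrM gtr0_norm//.
  have := Uu (Ordinal i_s); have := normr_ge0 (u 0 (Ordinal i_s)).
  by move: (`|_|) => w; nra.
exists (\sum_i m (delta_mx 0 i) *: s`_i) => l Cl.
have lsum (k : dual X) (a : 'I_n -> R) (w : 'I_n -> X) :
    k (\sum_i a i *: w i) = \sum_i a i * k (w i).
  rewrite (big_morph k (dualD k) (dual0 k)).
  by apply: eq_bigr => i _; rewrite dualZ.
have m0 := linear_form0 lm; have mD := linear_formD lm.
have mZ := linear_formZ lm.
have := mS (pr l) (-1) ltac:(by exists l).
rewrite {1}(row_sum_delta (pr l)) (big_morph m mD m0) => mle.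
rewrite -lerBlDl !lsum -sumrB; apply: le_trans mle.
apply: ler_sum => i _; rewrite mZ prE.
by rewrite -mulrBr mulrC.
Qed.

End Tvs.

(** * Affine sets, convex sets and epigraphs *)

Section AffineAndConvexSets.
Context {R : realType} {X : tvsType R}.

Lemma affine_set3 (A : set X) (x y z : X) (a b : R) :
  affine_set A -> A x -> A y -> A z -> A (x + a *: (y - x) + b *: (z - x)).
Proof.
(* this point is the middle of two points of the lines (x y) and (x z) *)
move=> aA Ax Ay Az.
have half : 1 - 2^-1 = 2^-1 :> R by field.
have -> : x + a *: (y - x) + b *: (z - x) =
    2^-1 *: ((2 * a) *: y + (1 - 2 * a) *: x) +
    (1 - 2^-1) *: ((2 * b) *: z + (1 - 2 * b) *: x).
  by module_eq R; field.
by apply: (aA); exact: aA.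
Qed.

Lemma convex_set_scaled (U : set X) (k : R) : convex_set U ->
  convex_set ([set k *: u | u in U] : set X).
Proof.
move=> /convex_setP cU.
apply/convex_setP => _ _ a b a0 b0 ab [u Uu <-] [w Uw <-].
exists (a *: u + b *: w); first exact: cU.
by module_eq R; ring.
Qed.

Lemma affine_aff (A : set X) : affine_set (aff A).
Proof. by move=> x y a Ax Ay B [aB AB]; apply: (aB); [exact: Ax|exact: Ay]. Qed.

End AffineAndConvexSets.

Section Epigraph.
Context {R : realType} {X : tvsType R}.
Implicit Types (f h : X -> \bar R) (D : set X).

Definition epi f : set (X * R^o) := [set p | (f p.1 <= p.2%:E)%E].

Lemma econvex_epi f : econvex f -> convex_set (epi f).
Proof.
move=> cf; apply/convex_setP => -[p r] [q s] a b a0 b0 ab.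
rewrite /epi/= => pr qs.
have -> : b = 1 - a by lra.
apply: le_trans (cf p q a a0 ltac:(lra)) _.
have b'0 : 0 < 1 - a by lra.
move: pr qs; case: (f p) => [u| |]//=; case: (f q) => [w| |]//= ur ws.
- rewrite -!EFinM -[X in (X <= _)%E]/((a * u + (1 - a) * w)%:E) lee_fin.
  rewrite !lee_fin in ur ws.
  by apply: lerD; rewrite ler_pM2l.
- by rewrite gt0_muleNy ?lte_fin// leNye.
- by rewrite gt0_muleNy ?lte_fin// leNye.
- by rewrite !gt0_muleNy ?lte_fin// leNye.
Qed.

Lemma epi_convex f (x y : X) (r s a b : R) : convex_set (epi f) ->
  0 < a -> 0 < b -> a + b = 1 -> (f x <= r%:E)%E -> (f y <= s%:E)%E ->
  (f (a *: x + b *: y)%R <= (a * r + b * s)%R%:E)%E.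
Proof.
move=> /convex_setP cf a0 b0 ab fx fy.
exact: (cf (x, r) (y, s) a b a0 b0 ab fx fy).
Qed.

Lemma eindicator_in h D y : D y -> (h y + eindicator D y)%dE = h y.
Proof.
move=> Dy; rewrite /eindicator mem_set//.
by case: (h y) => //= r; congr EFin; exact: addr0.
Qed.

Lemma eindicator_out h D y : ~ D y -> (h y + eindicator D y)%dE = +oo%E.
Proof. by move=> Dy; rewrite /eindicator memNset//; case: (h y). Qed.

Lemma epi_eindicator h D p :
  epi (fun y => h y + eindicator D y)%dE p <-> epi h p /\ D p.1.
Proof.
rewrite /epi/=; have [Dp|Dp] := pselect (D p.1).
  by rewrite eindicator_in//; split=> [|[]].
by rewrite eindicator_out//; split=> [|[]].
Qed.

Lemma convex_epi_eindicator h D : convex_set (epi h) -> convex_set D ->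
  convex_set (epi (fun y => h y + eindicator D y)%dE).
Proof.
move=> /convex_setP ch /convex_setP cD; apply/convex_setP => p q a b a0 b0 ab.
move=> /epi_eindicator[hp Dp] /epi_eindicator[hq Dq].
by apply/epi_eindicator; split; [exact: ch|exact: cD].
Qed.

Lemma epi_psup (T : Type) (F : T -> X -> \bar R) p :
  epi (psup F) p <-> forall t, epi (F t) p.
Proof.
split=> [Fp t|Fp]; last by apply: ub_ereal_sup => _ [t _ <-]; exact: Fp.
by apply: le_trans Fp; apply: ereal_sup_ubound; exists t.
Qed.

Lemma convex_epi_psup (T : Type) (F : T -> X -> \bar R) :
  (forall t, convex_set (epi (F t))) -> convex_set (epi (psup F)).
Proof.
move=> cF; apply/convex_setP => p q a b a0 b0 ab /epi_psup Fp /epi_psup Fq.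
by apply/epi_psup => t; move/convex_setP: (cF t); exact.
Qed.

Lemma lt_EFin_ub (z : \bar R) (a : R) : (z < a%:E)%E ->
  exists2 b, b < a & (z <= b%:E)%E.
Proof.
case: z => [r| |]//; first by rewrite lte_fin => ra; exists r.
by move=> _; exists (a - 1); [rewrite gtrBl|rewrite leNye].
Qed.

Lemma dom_epi f y : dom f y <-> exists r, epi f (y, r).
Proof.
rewrite /dom/epi/=; split=> [|[r]]; last first.
  by move/le_lt_trans; apply; rewrite ltry.
case: (f y) => [r _| |_]; [by exists r|by rewrite ltxx|].
by exists 0; exact: leNye.
Qed.

Lemma convex_dom f : convex_set (epi f) -> convex_set (dom f).
Proof.
move=> /convex_setP cf; apply/convex_setP => x y a b a0 b0 ab.
move=> /dom_epi[r xr] /dom_epi[s ys]; apply/dom_epi; exists (a * r + b * s).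
exact: (cf (x, r) (y, s)).
Qed.

End Epigraph.

(** * Separation by continuous linear forms *)

Section Separation.
Context {R : realType} {X : tvsType R}.

Lemma dual_below_convex (U : set X) (S : set (X * R^o)) (M : R) :
  convex_set U -> nbhs (0 : X) U -> convex_set S -> S !=set0 ->
  (forall k s g e, S (k, s) -> 0 < g -> U e -> k + g *: e = 0 ->
     0 <= s + g * M) ->
  exists l : dual X, forall k s, S (k, s) -> l k <= s.
Proof.
move=> cU U0 cS S0 SU.
have [m [lm mS [B mB]]] := linear_below_convex cU (nbhs0_absorbing U0) cS S0 SU.
by have [l lm'] := dual_of_linear lm U0 mB; exists l; rewrite lm'.
Qed.

(** The form has to be nonpositive on D - x and at most -1 at -v.  By
    [linear_below_convex] this is possible unless some y - x - rho v, with y in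
    D, is equal to - g e with e in U and g < rho; but then (y - x) / rho would
    be v - (g / rho) e, with (g / rho) e in U. *)
Lemma normal_separation (D U : set X) (x v : X) :
  convex_set D -> D x -> convex_set U -> nbhs (0 : X) U ->
  (forall e (a : R) y, U e -> 0 < a -> D y -> a *: (y - x) <> v - e) ->
  exists l : dual X, (forall y, D y -> l (y - x) <= 0) /\ 1 <= l v.
Proof.
move=> /convex_setP cD Dx cU U0 Uv.
pose S : set (X * R^o) := [set z | exists (y : X) (rho : R),
  [/\ D y, 0 <= rho & z = (y - x - rho *: v, - rho : R^o)]].
have [||k s g e|l lS] := @dual_below_convex U S 1 cU U0.
- apply/convex_setP => _ _ a b a0 b0 ab [y [r [Dy r0 ->]]] [z [s [Dz s0 ->]]].
  exists (a *: y + b *: z), (a * r + b * s).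
  split; [exact: cD|by rewrite addr_ge0// mulr_ge0// ltW|].
  have -> : b = 1 - a by lra.
  congr pair; rewrite /=; first by module_eq R; ring.
  by rewrite /GRing.scale/=; ring.
- by exists (x - x - 0 *: v, - 0), x, 0.
- move=> [y [r [Dy r0 [-> ->]]]] g0 Ue ye0; rewrite mulr1 addrC subr_ge0.
  rewrite leNgt; apply/negP => gr.
  have r_gt0 : 0 < r by rewrite (lt_trans g0).
  have Ure : U ((g / r) *: e).
    move/convex_setP : cU => /(_ e 0 (g / r) (1 - g / r)).
    rewrite scaler0 addr0; apply => //; first by rewrite divr_gt0.
    + by rewrite subr_gt0 ltr_pdivrMr// mul1r.
    + by rewrite addrC subrK.
    + exact: nbhs_singleton U0.
  apply: (Uv _ r^-1 y Ure) => //; first by rewrite invr_gt0.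
  have -> : v - (g / r) *: e =
      r^-1 *: (y - x) - r^-1 *: (y - x - r *: v + g *: e).
    by module_eq R; field; rewrite gt_eqF.
  by rewrite ye0 scaler0 subr0.
exists l; split => [y Dy|].
  have := lS _ _ (ex_intro _ y (ex_intro _ 0 (And3 Dy (lexx 0) erefl))).
  by rewrite scale0r subr0 oppr0.
have := lS _ _ (ex_intro _ x (ex_intro _ 1 (And3 Dx ler01 erefl))).
by rewrite scale1r subrr sub0r dualN lerN2.
Qed.

(** The form l has to lie below the points (y - x, r - h x), for (y, r) in the
    epigraph of h, and below (- v, - c); U and M ensure its continuity.  If a
    point y of the domain and a vector e of U are such that some convex
    combination of y and x + v + e lies on the ray from x through x + v, the
    upper bounds for h at y and at x + v + e and the lower bound along the ray
    are compatible: this is the condition of [linear_below_convex]. *)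
Lemma subgradient_of_ray h (A U : set X) (x v : X) (M c : R) :
  convex_set (epi h) -> h x \is a fin_num ->
  affine_set A -> dom h `<=` A -> A (x + v) ->
  convex_set U -> nbhs (0 : X) U ->
  (forall e, U e -> A (x + v + e) -> (h (x + v + e)%R <= M%:E)%E) ->
  (forall r : R, 0 <= r -> ((fine (h x) + r * c)%R%:E <= h (x + r *: v)%R)%E) ->
  exists2 l : dual X, subdifferential h x l & c <= l v.
Proof.
move=> ch hx aA dA Av cU U0 hM ray.
set alpha := fine (h x) in ray.
have hxE : h x = alpha%:E by rewrite fineK.
have Ax : A x by apply: dA; rewrite /dom/= hxE ltry.
pose S : set (X * R^o) := [set z | exists (y : X) (r rho : R),
  [/\ (h y <= r%:E)%E, 0 <= rho &
      z = (y - x - rho *: v, r - alpha - rho * c : R^o)]].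
(* M - alpha - c is the gap, at x + v + e, between M and the lower bound of h
   at x + v *)
have [||k s g e|l lS] := @dual_below_convex U S (M - alpha - c) cU U0.
- apply/convex_setP => _ _ a b a0 b0 ab [y [r [t [yr t0 ->]]]]
    [z [s [w [zs w0 ->]]]].
  exists (a *: y + b *: z), (a * r + b * s), (a * t + b * w).
  split; [exact: epi_convex|by rewrite addr_ge0// mulr_ge0// ltW|].
  have -> : b = 1 - a by lra.
  congr pair; rewrite /=; first by module_eq R; ring.
  by rewrite /GRing.scale/=; ring.
- by exists (x - x - 0 *: v, alpha - alpha - 0 * c), x, alpha, 0; rewrite hxE.
- move=> [y [r [t [yr t0 [-> ->]]]]] g0 Ue ye0.
  have g_neq0 : g != 0 by rewrite gt_eqF.
  have g1_gt0 : 0 < 1 + g by rewrite addr_gt0.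
  have eE : e = g^-1 *: (x - y + t *: v).
    have -> : x - y + t *: v = g *: e - (y - x - t *: v + g *: e).
      by module_eq R; ring.
    by rewrite ye0 subr0 scalerA mulVf// scale1r.
  have Ay : A y by apply: dA; exact: le_lt_trans yr (ltry _).
  have Ae : A (x + v + e).
    have -> : x + v + e = x + (1 + t / g) *: (x + v - x) + (- g^-1) *: (y - x).
      by rewrite eE; module_eq R; field.
    exact: affine_set3.
  have := epi_convex ch (_ : 0 < (1 + g)^-1) (_ : 0 < g / (1 + g)) _ yr
    (hM e Ue Ae).
  have -> : (1 + g)^-1 *: y + (g / (1 + g)) *: (x + v + e) =
      x + ((t + g) / (1 + g)) *: v.
    by rewrite eE; module_eq R; field; rewrite g_neq0 gt_eqF.
  have tg0 : 0 <= (t + g) / (1 + g) by rewrite divr_ge0// ?addr_ge0// ltW.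
  rewrite invr_gt0 divr_gt0// => /(_ g1_gt0 isT).
  move=> /(_ ltac:(by field; rewrite gt_eqF)) /(le_trans (ray _ tg0)).
  rewrite lee_fin -(ler_pM2l g1_gt0).
  have -> : (1 + g) * (alpha + (t + g) / (1 + g) * c) =
      (1 + g) * alpha + (t + g) * c.
    by field; rewrite gt_eqF.
  have -> : (1 + g) * ((1 + g)^-1 * r + g / (1 + g) * M) = r + g * M.
    by field; rewrite gt_eqF.
  lra.
exists l.
  split => // y; rewrite hxE.
  have ly (r : R) : (h y <= r%:E)%E -> l (y - x) <= r - alpha.
    move=> yr; have := lS _ _ (ex_intro _ y (ex_intro _ r (ex_intro _ 0
      (And3 yr (lexx 0) erefl)))).
    by rewrite scale0r mul0r !subr0.
  case hy : (h y) ly => [r| |] ly.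
  - by rewrite -EFinB lee_fin ly.
  - by rewrite addye// leey.
  - have := ly (l (y - x) + alpha - 1) (leNye _).
    by rewrite addrAC addrK leNgt gtrBl ltr01.
have := lS _ _ (ex_intro _ x (ex_intro _ alpha (ex_intro _ 1
  (And3 _ ler01 erefl)))).
rewrite hxE lexx => /(_ isT).
by rewrite !subrr scale1r mul1r !sub0r dualN lerN2.
Qed.

End Separation.

(** * Active indices along a ray *)

Section ActiveRay.
Context {R : realType} {X : tvsType R} {T : topologicalType}.
Context (F : T -> X -> \bar R) (cF : forall t, convex_set (epi (F t))).
Let f := psup F.

Lemma le_psup t y : (F t y <= f y)%E.
Proof. by apply: ereal_sup_ubound; exists t. Qed.

(** Convexity: slopes issued from x increase along the ray. *)
Lemma ray_le t (x v : X) (alpha c s r : R) :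
  (F t x <= alpha%:E)%E -> 0 < s -> s <= r ->
  ((alpha + s * c)%:E <= F t (x + s *: v)%R)%E ->
  ((alpha + r * c)%:E <= F t (x + r *: v)%R)%E.
Proof.
move=> Fx s0; rewrite le_eqVlt => /orP[/eqP <-//|sr] Fs.
rewrite leNgt; apply/negP => /lt_EFin_ub[b bc Fr].
have r0 : 0 < r by rewrite (lt_trans s0).
have := epi_convex (@cF t) (_ : 0 < 1 - s / r) (_ : 0 < s / r) _ Fx Fr.
have -> : (1 - s / r) *: x + (s / r) *: (x + r *: v) = x + s *: v.
  by module_eq R; field; rewrite gt_eqF.
rewrite subr_gt0 ltr_pdivrMr// mul1r divr_gt0// subrK.
move=> /(_ sr isT erefl)/(le_trans Fs).
rewrite lee_fin leNgt => /negP; apply.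
have -> : (1 - s / r) * alpha + s / r * b = alpha + s / r * (b - alpha) by ring.
rewrite ltrD2l -mulrA ltr_pM2l// ltr_pdivrMl// mulrC; nra.
Qed.

(** The sets A s of the indices t of T_e0(x) such that
    F t (x + s v) >= f x + s c are nested by [ray_le].  For small s > 0 they are
    nonempty: f (x + s v) > f x + s c, and an index that nearly attains
    f (x + s v) is e0-active at x because F t (x + v) <= f (x + v).  The index
    t is a cluster point of their filter. *)
Lemma active_ray (x v : X) (e0 c c' : R) :
  f x \is a fin_num -> 0 < e0 -> compact (eps_active F e0 x) ->
  (forall z, dom f z -> upper_semicontinuous
     ((F ^~ z) : subspace (eps_active F e0 x) -> \bar R)) ->
  dom f (x + v) -> c < c' ->
  (forall s : R, 0 <= s -> ((fine (f x) + s * c')%:E <= f (x + s *: v)%R)%E) ->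
  exists2 t, active F x t &
    forall r : R, 0 <= r -> ((fine (f x) + r * c)%:E <= F t (x + r *: v)%R)%E.
Proof.
move=> fx e0_gt0 cK usc dv cc' ray.
set alpha := fine (f x) in ray *.
have fxE : f x = alpha%:E by rewrite fineK.
have Fx t : (F t x <= alpha%:E)%E by rewrite -fxE le_psup.
have [beta fvE] : exists beta, f (x + v) = beta%:E.
  have := ray 1 ler01; rewrite scale1r.
  by move: dv; rewrite /dom/=; case: (f _) => // b; exists b.
have beta_ge : alpha + c' <= beta.
  by have := ray 1 ler01; rewrite scale1r mul1r fvE lee_fin.
have Fs (t : T) (s b : R) : 0 < s -> s < 1 -> (F t x <= b%:E)%E ->
    (F t (x + s *: v)%R <= ((1 - s) * b + s * beta)%R%:E)%E.
  move=> s0 s1 Fb.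
  have -> : x + s *: v = (1 - s) *: x + s *: (x + v) by module_eq R; ring.
  apply: epi_convex => //; [by rewrite subr_gt0|by rewrite subrK|].
  by rewrite -fvE le_psup.
set K := eps_active F e0 x in cK usc *.
pose A (s : R) := [set t | K t /\ ((alpha + s * c)%:E <= F t (x + s *: v)%R)%E].
(* s0 is chosen so that s <= s0 forces the indices of A s to be e0-active at x:
   otherwise e0 < s * N *)
pose N := beta - alpha - c + e0.
have N0 : 0 < N by rewrite /N; lra.
pose s0 := e0 / (N + e0).
have Ne0 : 0 < N + e0 by rewrite addr_gt0.
have s0_gt0 : 0 < s0 by rewrite divr_gt0.
have s0_lt1 : s0 < 1 by rewrite ltr_pdivrMr// mul1r ltrDr.
have s0N : s0 * N < e0.
  have : s0 * (N + e0) = e0 by rewrite /s0 divfK// gt_eqF.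
  by rewrite mulrDr => h; have : 0 < s0 * e0 by [rewrite mulr_gt0]; lra.
have A_nonempty s : 0 < s -> s <= s0 -> A s !=set0.
  move=> s_gt0 ss0; have s_lt1 : s < 1 by exact: le_lt_trans s0_lt1.
  have : ((alpha + s * c)%:E < f (x + s *: v)%R)%E.
    by apply: lt_le_trans (ray s (ltW s_gt0)); rewrite lte_fin ltrD2l ltr_pM2l.
  move=> /ereal_sup_gt[_ [t _ <-] Ft]; exists t; split; last exact: ltW.
  rewrite /K/eps_active/= -/f fxE -EFinB leNgt; apply/negP.
  move=> /lt_EFin_ub[b bae /(Fs _ _ _ s_gt0 s_lt1)] /(lt_le_trans Ft).
  rewrite lte_fin.
  have : s * N <= s0 * N by rewrite ler_pM2r.
  rewrite /N in s0N * => h1 h2.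
  have : (1 - s) * b <= (1 - s) * (alpha - e0).
    by rewrite ler_pM2l ?subr_gt0// ltW.
  nra.
have A_sub s r : 0 < s -> s <= r -> A s `<=` A r.
  by move=> s_gt0 sr t [Kt At]; split => //; exact: ray_le At.
pose D : set R := [set s | 0 < s /\ s <= s0].
have FF : ProperFilter (filter_from D A).
  apply: filter_from_proper.
    apply: filter_from_filter; first by exists s0.
    move=> s r [s_gt0 ss0] [r_gt0 rs0]; exists (Num.min s r).
      by rewrite /D/= lt_min s_gt0 r_gt0 ge_min ss0.
    have m0 : 0 < Num.min s r by rewrite lt_min s_gt0.
    by move=> t At; split; apply: A_sub At; rewrite // ge_min lexx ?orbT.
  by move=> s [s_gt0 ss0]; exact: A_nonempty.
have [t [Kt clt]] : K `&` cluster (filter_from D A) !=set0.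
  by apply: cK; exists s0 => // t [].
have At s : 0 < s -> s <= s0 -> ((alpha + s * c)%:E <= F t (x + s *: v)%R)%E.
  move=> s_gt0 ss0; rewrite leNgt; apply/negP => Fts.
  have s_lt1 : s < 1 by exact: le_lt_trans s0_lt1.
  have ds : dom f (x + s *: v).
    apply/dom_epi; exists ((1 - s) * alpha + s * beta).
    by apply/epi_psup => u; apply: Fs => //; exact: Fx.
  have [W tW WF] := usc _ ds t _ Fts.
  have {}tW : within K (nbhs t) W by rewrite (nbhs_subspace_in Kt).
  have [u [[Ku Au] Wu]] : A s `&` [set u | K u -> W u] !=set0.
    by apply: clt => //; exists s.
  by have := le_lt_trans Au (WF _ (Wu Ku)); rewrite ltxx.
have tx : F t x = alpha%:E.
  apply/eqP; rewrite eq_le Fx/= leNgt; apply/negP => /lt_EFin_ub[b ba Fb].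
  suff : alpha <= b by rewrite leNgt ba.
  apply: (@ler_affine_near0 _ s0 _ c _ (beta - b)) => // s s_gt0 ss0.
  have s_lt1 : s < 1 by exact: le_lt_trans s0_lt1.
  have := le_trans (At _ s_gt0 ss0) (Fs t s b s_gt0 s_lt1 Fb).
  by rewrite lee_fin => /le_trans; apply; lra.
exists t => [|r]; first by rewrite /active/= -/f fxE.
rewrite le_eqVlt => /orP[/eqP <-|r0]; first by rewrite mul0r scale0r !addr0 tx.
have m0 : 0 < Num.min s0 r by rewrite lt_min s0_gt0.
apply: (@ray_le t x v alpha c (Num.min s0 r) r) => //.
  by rewrite ge_min lexx orbT.
by apply: At => //; rewrite ge_min lexx.
Qed.

End ActiveRay.

(** * The subdifferential as a subset of the dual *)

Section Subdifferential.
Context {R : realType} {X : tvsType R}.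
Implicit Types (h : X -> \bar R).

Lemma subdifferentialE h x : h x \is a fin_num ->
  subdifferential h x = \bigcap_(y in [set: X])
    [set l : dual X | ((l (y - x)%R)%:E <= h y - h x)%E].
Proof.
move=> hx; apply/seteqP; split=> [l [_ lh] y _|l lh]; first exact: lh.
by split => // y; exact: lh.
Qed.

Lemma closed_subdifferential h x : closed (subdifferential h x).
Proof.
have [hx|hx] := boolP (h x \is a fin_num); last first.
  rewrite (_ : subdifferential h x = set0); first exact: closed0.
  by rewrite -subset0 => l [hx']; rewrite hx' in hx.
rewrite subdifferentialE//; apply: closed_bigI => y _.
case: (h y - h x)%E => [r| |].
- rewrite (_ : [set _ | _] =
      (fun l : dual X => l (y - x) : R^o) @^-1` [set s | s <= r]).
    apply: (closed_comp _ (@closed_le _ r)) => l _.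
    exact: dual_eval_continuous.
  by apply/seteqP; split => l /=; rewrite lee_fin.
- rewrite (_ : [set _ | _] = setT); first exact: closedT.
  by apply/seteqP; split => l //= _; rewrite leey.
- rewrite (_ : [set _ | _] = set0); first exact: closed0.
  by apply/seteqP; split => l.
Qed.

Lemma convex_subdifferential h x : convex_set (subdifferential h x).
Proof.
apply/convex_setP => l k a b a0 b0 ab [hx lh] [_ kh]; split => // y.
have -> : (a *: l + b *: k) (y - x) = a * l (y - x) + b * k (y - x) by [].
move: (lh y) (kh y); case: (h y - h x)%E => [r| |]//.
- rewrite !lee_fin => lr kr; rewrite -[r]mul1r -ab mulrDl.
  by apply: lerD; rewrite ler_pM2l.
- by rewrite !leey.
Qed.

Lemma subdifferential_addr_normal h D x (l n : dual X) (a : R) : 0 <= a ->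
  dom h `<=` D -> subdifferential h x l -> (forall y, D y -> n (y - x) <= 0) ->
  subdifferential h x (l + a *: n).
Proof.
move=> a0 hD [hx lh] nD; split => // y.
have -> : (l + a *: n) (y - x) = l (y - x) + a * n (y - x) by [].
have [Dy|Dy] := pselect (D y).
  by apply: le_trans (lh y); rewrite lee_fin gerDl mulr_ge0_le0// nD.
have -> : h y = +oo%E.
  by apply/eqP; rewrite -leye_eq leNgt; apply/negP => /hD.
by rewrite addye ?leey//; move: hx; case: (h x).
Qed.

End Subdifferential.

(** * Subgradients at active indices *)

Section SubdifferentialSupremum.
Context {R : realType} {X : tvsType R} {T : topologicalType}.
Context (F : T -> X -> \bar R) (cF : forall t, convex_set (epi (F t))).
Let f := psup F.
Let h t y := (F t y + eindicator (dom f) y)%dE.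

Let cf : convex_set (epi f). Proof. exact: convex_epi_psup. Qed.

Let ch t : convex_set (epi (h t)).
Proof. by apply: convex_epi_eindicator; [exact: cF|exact: convex_dom]. Qed.

Let domh t : dom (h t) `<=` dom f.
Proof. by move=> y /dom_epi[r /epi_eindicator[]]. Qed.

Lemma active_subdifferential_sub t x :
  active F x t -> subdifferential (h t) x `<=` subdifferential f x.
Proof.
move=> tx l [hx lh].
have dx : dom f x.
  by apply: (@domh t); rewrite /dom/= ltey_eq hx.
have hxE : h t x = f x by rewrite /h eindicator_in.
split => [|y]; first by rewrite -hxE.
have [dy|dy] := pselect (dom f y).
  apply: le_trans (lh y) _; rewrite hxE /h eindicator_in//.
  by apply: leeB => //; exact: le_psup.
have -> : f y = +oo%E by apply/eqP; rewrite -leye_eq leNgt; apply/negP.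
by rewrite hxE in hx; rewrite addye ?leey//; move: hx; case: (f x).
Qed.

Context (x : X) (e0 : R) (e0_gt0 : 0 < e0).
Context (cK : compact (eps_active F e0 x)).
Context (usc : forall z, dom f z ->
  upper_semicontinuous ((F ^~ z) : subspace (eps_active F e0 x) -> \bar R)).
Context (l0 : dual X) (l0f : subdifferential f x l0).

Let alpha := fine (f x).
Let fxE : f x = alpha%:E. Proof. by rewrite fineK//; case: l0f. Qed.
Let dx : dom f x. Proof. by rewrite /dom/= fxE ltry. Qed.

Let l0_le y r : epi f (y, r) -> l0 (y - x) <= r - alpha.
Proof.
rewrite /epi/= => fy; rewrite -lee_fin EFinB -fxE.
by apply: le_trans (l0f.2 y) _; apply: leeB.
Qed.

(** [active_ray] provides the index t, then [subgradient_of_ray] applies to h t: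
    an upper bound for f on dom f is one for h t. *)
Lemma interior_active_subgradient (A U : set X) (v : X) (M eta : R) :
  affine_set A -> dom f `<=` A -> A (x + v) ->
  convex_set U -> nbhs (0 : X) U ->
  (forall e, U e -> A (x + v + e) -> (f (x + v + e)%R <= M%:E)%E) ->
  0 < eta ->
  exists t l, [/\ active F x t, subdifferential (h t) x l & l0 v - eta <= l v].
Proof.
move=> aA dA Av cU U0 fM eta0.
have fdom e : U e -> A (x + v + e) -> dom f (x + v + e).
  by move=> Ue Ae; exact: le_lt_trans (fM _ Ue Ae) (ltry _).
have [|||s s_ge0|t tx ray] :=
  @active_ray R X T F cF x v e0 (l0 v - eta) (l0 v) _ e0_gt0 cK usc.
- by case: l0f.
- have := @fdom 0; rewrite addr0; apply => //; exact: nbhs_singleton U0.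
- by rewrite gtrBl.
- have := l0f.2 (x + s *: v).
  by rewrite [_ + _ - x]addrC addKr dualZ -/f fxE leeBrDr// -EFinD addrC.
have htx : h t x = alpha%:E by rewrite /h eindicator_in// tx.
have [||||l hl vl] :=
  @subgradient_of_ray R X (h t) A U x v M (l0 v - eta) (@ch t) _ aA _ Av cU U0.
- by rewrite htx.
- by move=> y /domh /dA.
- move=> e Ue Ae; rewrite /h eindicator_in; last exact: fdom.
  exact: le_trans (le_psup _ _ _) (fM e Ue Ae).
- move=> r r0; rewrite htx /h.
  have [dr|dr] := pselect (dom f (x + r *: v)).
    by rewrite eindicator_in//; exact: ray.
  by rewrite eindicator_out// leey.
by exists t, l.
Qed.

(** Here f is bounded above around z0 only.  When v is a limit of vectors
    a (y - x), with y in the domain of f, the previous lemma applies to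
    v + k (z0 - x): if v = a (y - x) + k d with d small, the points around
    x + (v + k (z0 - x)) / (a + k) are barycentres of y and of points around z0.
    Because l (z0 - x) <= f z0 - f x, replacing v with v + k (z0 - x) costs at
    most k * (N - 1); the remaining k is the error of the previous lemma, scaled
    by a + k.  The directions v that are not such limits are separated from the
    cone by a continuous form that can be added to any subgradient. *)
Lemma active_subgradient (A W : set X) (z0 v : X) (M eps : R) :
  affine_set A -> closed A -> dom f `<=` A -> dom f z0 ->
  nbhs (0 : X) W ->
  (forall e, W e -> A (z0 + e) -> (f (z0 + e)%R <= M%:E)%E) ->
  0 < eps ->
  exists t l, [/\ active F x t, subdifferential (h t) x l & l0 v - eps <= l v].
Proof.
move=> aA clA dA dz0 /nbhs_convex[W1 [cW1 W10 W1W]] fM eps0.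
have {W1W}fM e : W1 e -> A (z0 + e) -> (f (z0 + e)%R <= M%:E)%E.
  by move=> /W1W; exact: fM.
pose w := z0 - x.
have xw : x + w = z0 by rewrite addrC subrK.
have Ax : A x by exact: dA.
have Az0 : A z0 by exact: dA.
have [[U [cU U0 Uv]]|noU] := pselect (exists U,
    [/\ convex_set U, nbhs (0 : X) U &
    forall e (a : R) y, U e -> 0 < a -> dom f y -> a *: (y - x) <> v - e]).
  have [n [nD nv]] := normal_separation (convex_dom cf) dx cU U0 Uv.
  have [|||t [l [tx hl _]]] :=
    @interior_active_subgradient A W1 w M 1 aA dA _ cW1 W10.
  - by rewrite xw.
  - by move=> e; rewrite xw; exact: fM.
  - by [].
  exists t, (l + `|l0 v - l v| *: n); split => //.
    by apply: subdifferential_addr_normal nD => //; exact: domh.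
  have -> : (l + `|l0 v - l v| *: n) v = l v + `|l0 v - l v| * n v by [].
  have : l0 v - l v <= `|l0 v - l v| * n v.
    by rewrite (le_trans (ler_norm _))// ler_peMr.
  by lra.
(* from now on v is a limit of vectors of the cone generated by dom f - x *)
have {}noU U : convex_set U -> nbhs (0 : X) U -> exists e (a : R) y,
    [/\ U e, 0 < a, dom f y & a *: (y - x) = v - e].
  move=> cU U0; apply: contrapT => noe; apply: noU; exists U; split => //.
  by move=> e a y Ue a0 dy ye; apply: noe; exists e, a, y.
(* A is closed and x + v is a limit of points of A *)
have Axv : A (x + v).
  apply: contrapT => nAxv.
  have : nbhs (x + v) (~` A).
    by apply: open_nbhs_nbhs; split => //; exact: closed_openC.
  move=> /nbhsD0 /nbhs0N /nbhs_convex[U [cU U0 UA]].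
  have [e [a [y [/UA[e' Ae' e'e] a0 dy ye]]]] := noU U cU U0.
  apply: Ae'; rewrite -[e']opprK e'e -addrA -ye.
  have -> : x + a *: (y - x) = x + a *: (y - x) + 0 *: (x - x).
    by module_eq R; ring.
  by apply: affine_set3 => //; exact: dA.
(* W2 is half of W1, so that W2 + W2 is contained in W1 *)
pose W2 := [set 2^-1 *: u | u in W1].
have cW2 : convex_set W2 by exact: convex_set_scaled.
have W20 : nbhs (0 : X) W2 by apply: nbhs0Z.
have W2D d e : W2 d -> W2 e -> W1 (d + e).
  move=> [d' Wd <-] [e' We <-].
  by move/convex_setP : cW1; apply => //; field.
have [beta z0E] : exists beta, epi f (z0, beta) by apply/dom_epi.
pose N := beta - alpha - l0 w + 1.
have N1 : 1 <= N by have := l0_le z0E; rewrite /N -/w; lra.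
have N0 : 0 < N by exact: lt_le_trans N1.
pose k := eps / N.
have k0 : 0 < k by rewrite divr_gt0.
have kN : k * N = eps by rewrite /k divfK// gt_eqF.
have k_neq0 : k != 0 by rewrite gt_eqF.
have [|_ [a [y [[d Wd <-] a0 dy yv]]]] :=
    noU [set k *: u | u in W2] (convex_set_scaled cW2).
  exact: nbhs0Z.
have Ay : A y by exact: dA.
have vE : v = a *: (y - x) + k *: d by rewrite yv subrK.
pose s := a + k.
have s0 : 0 < s by rewrite addr_gt0.
have s_neq0 : s != 0 by rewrite gt_eqF.
have s_def : s = a + k by [].
pose v' := s^-1 *: (v + k *: w).
have [gamma yE] : exists gamma, epi f (y, gamma) by apply/dom_epi.
have [|||||t [l [tx hl lv']]] := @interior_active_subgradient A
    [set (k / s) *: u | u in W2] v' (a / s * gamma + k / s * M) (k / s) aA dA.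
- have -> : x + v' = x + s^-1 *: (x + v - x) + (k / s) *: (z0 - x).
    by rewrite /v' /w; module_eq R; field.
  exact: affine_set3.
- exact: convex_set_scaled.
- by apply: nbhs0Z => //; rewrite mulf_neq0// invr_eq0.
- move=> _ [e We <-] Ae.
  have Ade : A (z0 + (d + e)).
    have -> : z0 + (d + e) =
        x + (s / k) *: (x + v' + (k / s) *: e - x) + (- (a / k)) *: (y - x).
      rewrite /v' /w vE; module_eq R; rewrite s_def; field;
        by rewrite ?k_neq0 -?s_def ?s_neq0.
    exact: affine_set3.
  have -> : x + v' + (k / s) *: e = (a / s) *: y + (k / s) *: (z0 + (d + e)).
    rewrite /v' /w vE; module_eq R; rewrite s_def; field;
      by rewrite ?k_neq0 -?s_def ?s_neq0.
  apply: epi_convex => //; [exact: divr_gt0|exact: divr_gt0| |].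
    by rewrite -mulrDl divff.
  by apply: fM => //; exact: W2D.
- exact: divr_gt0.
exists t, l; split => //.
have lw : l w <= beta - alpha.
  have [fx lf] := active_subdifferential_sub tx hl.
  rewrite -lee_fin EFinB -fxE; apply: le_trans (lf z0) _.
  by apply: leeB.
move: lv'; rewrite /v' !dualZ !dualD !dualZ -(ler_pM2l s0).
rewrite mulrBr !mulVKf// [s * (k / s)]mulrC divfK//.
have : k * l w <= k * (beta - alpha) by rewrite ler_pM2l.
rewrite /N in kN; nra.
Qed.

End SubdifferentialSupremum.

Theorem theorem1 (R : realType) (X : tvsType R) (T : topologicalType)
    (f_ : T -> X -> \bar R) :
  let f := psup f_ in
  hausdorff_space X ->
  (forall t, econvex (f_ t)) ->
  ri (dom f) !=set0 ->
  (forall z, ri (dom f) z ->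
     f z \is a fin_num /\
     {for z, continuous (f : subspace (aff (dom f)) -> \bar R)}) ->
  lsc_envelope f = psup (fun t => lsc_envelope (f_ t)) ->
  forall (x : X) (e0 : R), 0 < e0 ->
  compact (eps_active f_ e0 x) ->
  (forall z, dom f z ->
     upper_semicontinuous
       ((fun t => f_ t z) : subspace (eps_active f_ e0 x) -> \bar R)) ->
  subdifferential f x =
  closed_convex_hull
    (\bigcup_(t in active f_ x)
       subdifferential (fun y => f_ t y + eindicator (dom f) y)%dE x).
Proof.
move=> f _ ecf [z0 riz0] contf _ x e0 e0_gt0 cK usc.
have cF t : convex_set (epi (f_ t)) by exact: econvex_epi.
apply/seteqP; split; last first.
  apply: smallest_sub; last first.
    by move=> l [t tx]; apply: active_subdifferential_sub.
  by split; [exact: convex_subdifferential|exact: closed_subdifferential].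
have [fz0 fcont] := contf _ riz0.
have [clA _] := riz0.
have dA : dom f `<=` aff (dom f) by exact: sub_smallest.
have dz0 : dom f z0 by rewrite /dom/= ltey_eq fz0.
pose M := fine (f z0) + 1.
have /fcont : nbhs (f z0) [set y | (y < M%:E)%E].
  apply: open_nbhs_nbhs; split; first exact: open_ereal_lt_ereal.
  by rewrite /= -(fineK fz0) lte_fin ltrDl.
move=> fM; have : within (aff (dom f)) (nbhs z0) [set y | (f y < M%:E)%E].
  by rewrite (nbhs_subspace_in (dA _ dz0)).
move=> /nbhsD0 Wz0.
have step l0 v eps : subdifferential f x l0 -> 0 < eps -> exists t l,
  [/\ active f_ x t,
      subdifferential (fun y => f_ t y + eindicator (dom f) y)%dE x l &
      l0 v - eps <= l v].
  move=> l0f; apply: (active_subgradient cF e0_gt0 cK usc l0f v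
    (@affine_aff _ _ _) clA dA dz0 Wz0).
  by move=> e We Ae; exact/ltW/We.
move=> l0 l0f C [[cC clC] sC]; apply: contrapT => Cl0.
have [|v vC] := dual_separation cC clC _ Cl0.
  have [t [l [tx hl _]]] := step l0 0 1 l0f ltr01.
  by exists l; apply: sC; exists t.
have [t [l [tx hl lv]]] := step l0 v 2^-1 l0f ltac:(by rewrite invr_gt0).
have : l v <= l0 v - 1 by apply: vC; apply: sC; exists t.
lra.
Qed.
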